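(* Let $\lambda>0$ and let $f$ be a non-negative $C^\infty$-function defined on $(0,\infty)$. Then the function $x^{1-\lambda}\left(x^\lambda f(x)\right)'=\lambda f(x)+xf'(x)$ is completely monotonic if and only if $$f(x)=\alpha+\frac{\beta}{x^{\lambda}}+\int_0^{\infty}e^{-xs}s^{\lambda-1}\int_s^{\infty}\frac{d\mu(t)}{t^{\lambda}}\,ds,\quad x>0,$$ for some non-negative numbers $\alpha$ and $\beta$ and some positive measure $\mu$ on $(0,\infty)$ making the integral convergent (for all $x>0$).
   Context: A function $g\in C^\infty((0,\infty))$ is completely monotonic if $(-1)^ng^{(n)}(x)\geq 0$ for all $n\geq 0$ and $x>0$. *)

(* Defs.v *)
From mathcomp Require Import all_boot all_order all_algebra.
From mathcomp Require Import all_classical all_reals all_analysis.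

Set Implicit Arguments.
Unset Strict Implicit.
Unset Printing Implicit Defensive.

Import Order.TTheory GRing.Theory Num.Theory.
Import numFieldNormedType.Exports.

Local Open Scope classical_set_scope.
Local Open Scope ring_scope.

(* A function on (0, oo) is represented by a total function R -> R whose values
   outside (0, oo) are irrelevant: since (0, oo) is open, the iterated
   derivatives at x > 0 depend only on the values on (0, oo). *)

Definition smooth_pos (R : realType) (g : R -> R) : Prop :=
  forall (n : nat) (x : R), 0 < x -> derivable (derive1n n g) x 1.

Definition completely_monotonic (R : realType) (g : R -> R) : Prop :=
  smooth_pos g /\
  forall (n : nat) (x : R), 0 < x -> 0 <= (-1) ^+ n * derive1n n g x.

(* A positive Borel measure on (0, oo) is represented by its extension by zero
   to the Borel sets of the real line. *)
Definition measure_on_pos (R : realType)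
    (mu : {measure set (measurableTypeR R) -> \bar R}) : Prop :=
  mu (~` `]0, +oo[) = 0%E.

(* The integrand is non-negative, so the integral always has a value in
   [0, +oo], and it converges if and only if this value is not +oo.  The range
   of the inner integral contains the endpoint s. *)
Definition cm_integral (R : realType) (lambda : R)
    (mu : {measure set (measurableTypeR R) -> \bar R}) (x : R) : \bar R :=
  (\int[lebesgue_measure]_(s in `]0%R, +oo[)
     ((expR (- (x * s)) * s `^ (lambda - 1))%:E *
      \int[mu]_(t in `[s, +oo[) ((t `^ lambda)^-1)%:E))%E.

(* Main.v *)
From HB Require Import structures.
Require Import Defs.
From mathcomp Require Import all_boot all_order all_algebra.
From mathcomp Require Import all_classical all_reals all_analysis.
From mathcomp Require Import measurable_realfun.
From mathcomp Require Import ring lra.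

Import Order.TTheory GRing.Theory Num.Theory.
Import numFieldNormedType.Exports.

Local Open Scope classical_set_scope.
Local Open Scope ring_scope.

Set Implicit Arguments.
Unset Strict Implicit.
Unset Printing Implicit Defensive.

(* Put [g x = x^(1-lambda) (x^lambda f)'], so that [x^lambda f x] has derivative
   [x^(lambda-1) g x].  If [g] is completely monotonic, Bernstein's theorem writes
   [g = c + G] with [G] the Laplace transform of a measure [mu] on (0, oo).
   Integrating from 0 gives
   [x^lambda f x = beta + c x^lambda / lambda + \int_0^x y^(lambda-1) G y dy], where
   [beta] is the limit of [x^lambda f x] at 0, and by Tonelli the last integral is
   [x^lambda] times the integral of the statement.  The converse runs the same
   identity backwards and differentiates [G] under the integral sign.

   Bernstein's theorem is proved following Feller.  The Taylor series of [g] at [a]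
   converges on (0, a) and, evaluated at [a - a e^(-x/a)], reads
   [g (a (1 - e^(-x/a))) = \sum_k (-a)^k g^(k)(a) / k! e^(-x k/a)]: the Laplace
   transform of a discrete measure, which tends to [g x] as [a] tends to oo.  Helly
   selection applied to the cumulative functions of these measures, followed by
   dominated convergence, produces the cumulative function of the limit measure. *)

(** * Taylor expansion of completely monotonic functions *)

Section absolutely_monotonic_taylor.
Context {R : realType}.
Implicit Types (d : nat -> R -> R) (b h s : R) (n : nat).

Lemma ge0_is_derive_le (f df : R -> R) (a b : R) :
  (forall x, a <= x < b -> is_derive x 1 f (df x)) ->
  (forall x, a <= x < b -> 0 <= df x) ->
  forall x y, a <= x -> x <= y -> y < b -> f x <= f y.
Proof.
move=> fdf df0 x y ax xy yb.
have ab z : z \in `]a, b[ -> a <= z < b.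
  by rewrite in_itv/= => /andP[/ltW -> ->].
apply: (@ger0_derive1_le_co _ f a b) => //.
- by move=> z /ab /fdf[].
- by move=> z /ab zab; rewrite derive1E (@derive_val _ _ _ _ _ _ _ (fdf z zab)) df0.
- apply: continuous_in_subspaceT => z /set_mem /=; rewrite in_itv/= => zab.
  apply: differentiable_continuous; apply/derivable1_diffP.
  by case: (fdf z zab).
- by rewrite in_itv/= ax (le_lt_trans xy).
- by rewrite in_itv/= yb (le_trans ax).
Qed.

(** [d k] stands for the k-th derivative of [d 0]. With the derivatives carried as a family,
    differentiating amounts to shifting the index. *)
Definition taylor_poly n d : {poly R} := \poly_(i < n) (d i 0 / i`!%:R).

Definition taylor_rem n d h := d 0%N h - (taylor_poly n d).[h].

(** Differentiability is asked for every [x < b], so that the two-sided derivative exists at the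
    expansion point 0; the signs are prescribed on [[0, b)] only. *)
Definition absolutely_monotonic_family d b :=
  (forall k x, x < b -> is_derive x 1 (d k) (d k.+1 x)) /\
  (forall k x, 0 <= x < b -> 0 <= d k x).

Lemma absolutely_monotonic_familyS d b : absolutely_monotonic_family d b ->
  absolutely_monotonic_family (fun k => d k.+1) b.
Proof. by move=> [d1 d2]; split=> k x *; [exact: d1|exact: d2]. Qed.

Lemma taylor_remS0 n d : taylor_rem n.+1 d 0 = 0.
Proof.
rewrite /taylor_rem horner_coef0 coef_poly/= fact0 divr1 subrr//.
Qed.

Lemma is_derive_taylor_rem n d b h : absolutely_monotonic_family d b -> h < b ->
  is_derive h 1 (taylor_rem n.+1 d) (taylor_rem n (fun k => d k.+1) h).
Proof.
move=> [dd _] hb; have := is_deriveB (dd 0%N h hb)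
  (is_derive_poly (taylor_poly n.+1 d) h).
congr (is_derive _ _ _ (_ - _)).
suff -> : (taylor_poly n.+1 d)^`() = taylor_poly n (fun k => d k.+1) by [].
apply/polyP => i; rewrite coef_deriv !coef_poly ltnS; case: ifP => // _.
  rewrite factS natrM invfM -mulr_natr; field.
  by rewrite pnatr_eq0 -lt0n fact_gt0 addrC natr1 pnatr_eq0.
by rewrite mul0rn.
Qed.

(** Induction on [n]: the remainder of order [n.+1] vanishes at 0, and its derivative is the
    remainder of order [n] of the shifted family. *)
Lemma taylor_rem_ge0 n d b h : absolutely_monotonic_family d b ->
  0 <= h < b -> 0 <= taylor_rem n d h.
Proof.
elim: n d h => [|n ih] d h db /andP[h0 hb].
  by rewrite /taylor_rem /taylor_poly poly_def big_ord0 horner0 subr0; apply db.2;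
    rewrite h0.
rewrite -(taylor_remS0 n d).
apply: (@ge0_is_derive_le _ (taylor_rem n (fun k => d k.+1)) 0 b) => //.
- by move=> x /andP[x0 xb]; exact: is_derive_taylor_rem db xb.
- by move=> x xb; apply: ih xb; exact: absolutely_monotonic_familyS.
Qed.

(** The right side minus the left vanishes at 0, and its derivative is [t] times the same difference
    one order lower for the shifted family. At order 0 the claim is that [d 0] is nondecreasing. *)
Lemma taylor_rem_scale n d b (t h : R) : absolutely_monotonic_family d b ->
  0 <= t <= 1 -> 0 <= h < b ->
  taylor_rem n d (t * h) <= t ^+ n * taylor_rem n d h.
Proof.
move=> + /andP[t0 t1]; elim: n d h => [|n ih] d h db /andP[h0 hb].
  rewrite expr0 mul1r /taylor_rem lerB//; last first.
    by rewrite /taylor_poly poly_def big_ord0 !horner0.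
  apply: (@ge0_is_derive_le _ (d 1%N) 0 b) => //.
  - by move=> x /andP[_ xb]; apply db.1.
  - by move=> x xb; apply db.2.
  - by rewrite mulr_ge0.
  - by rewrite ler_piMl.
rewrite -subr_ge0; set d' := fun k => d k.+1.
have th x : 0 <= x < b -> 0 <= t * x < b.
  move=> /andP[x0 xb]; rewrite mulr_ge0//=.
  by apply: le_lt_trans xb; rewrite ler_piMl.
pose phi (x : R) := t ^+ n.+1 * taylor_rem n.+1 d x - taylor_rem n.+1 d (t * x).
pose dphi (x : R) := t * (t ^+ n * taylor_rem n d' x - taylor_rem n d' (t * x)).
suff : phi 0 <= phi h by rewrite /phi mulr0 !taylor_remS0 mulr0 subrr.
apply: (@ge0_is_derive_le _ dphi 0 b) => //; last first.
  move=> x xb; rewrite /dphi mulr_ge0// subr_ge0 ih//.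
  exact: absolutely_monotonic_familyS.
move=> x xb; have /andP[_ xb1] := xb; have /andP[_ xb2] := th _ xb.
have h1 := is_derive_taylor_rem n db xb1.
have h2 := is_derive_taylor_rem n db xb2.
have h3 : is_derive x 1 (fun y : R => t * y) t.
  by have := is_deriveZ t (is_derive_id x 1); rewrite /GRing.scale/= mulr1.
have h4 := @is_derive1_comp _ _ _ _ _ _ h2 h3.
have := is_deriveB (is_deriveZ (t ^+ n.+1) h1) h4.
congr (is_derive _ _ _ _).
by rewrite /dphi /GRing.scale/= exprS /d'; ring.
Qed.

(* The bound [rem (t h) <= t ^ n * rem h <= t ^ n * d 0 h] on the remainder of
   order [n] holds on the whole interval, so no analytic continuation is needed
   beyond half of the radius, where the estimate from Lagrange's form stops. *)
Lemma absolutely_monotonic_taylor_cvg d b h : absolutely_monotonic_family d b ->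
  0 <= h < b -> (taylor_poly n d).[h] @[n --> \oo] --> d 0%N h.
Proof.
move=> db /andP[h0 hb].
(* The midpoint [s] leaves room beyond [h]: since [h = t * s] with [t < 1], the remainder at [h] is
   at most [t ^ n * d 0 s]. *)
pose s := (h + b) / 2; pose t := h / s.
have [hs sb] : h < s /\ s < b by rewrite /s; split; lra.
have s0 : 0 < s by rewrite (le_lt_trans h0).
have t01 : 0 <= t < 1.
  by rewrite divr_ge0 ?(ltW s0)//= ltr_pdivrMr// mul1r.
have /andP[t0 t1] := t01.
have ts : t * s = h by rewrite /t divfK ?gt_eqF.
suff rem0 : taylor_rem n d h @[n --> \oo] --> 0.
  have -> : (fun n => (taylor_poly n d).[h]) = (fun n => d 0%N h - taylor_rem n d h).
    by apply/funext => n; rewrite /taylor_rem subKr.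
  by rewrite -[X in _ --> X]subr0; apply: cvgB rem0; exact: cvg_cst.
apply: (@squeeze_cvgr _ _ _ _ (cst 0) (geometric (d 0%N s) t)).
- apply: nearW => n; rewrite (taylor_rem_ge0 _ db) ?h0//=.
  have hts : taylor_rem n d (t * s) <= t ^+ n * taylor_rem n d s.
    by apply: taylor_rem_scale db _ _; rewrite ?t0 ?(ltW t1) ?(ltW s0).
  rewrite ts in hts; rewrite (le_trans hts)//= mulrC ler_wpM2r ?exprn_ge0//.
  rewrite /taylor_rem gerBl.
  rewrite /taylor_poly poly_def horner_sum sumr_ge0// => i _.
  rewrite hornerZ hornerXn mulr_ge0// ?exprn_ge0 ?(ltW s0)//.
  rewrite divr_ge0//; apply db.2; rewrite lexx/=.
  by rewrite (lt_trans s0).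
- exact: cvg_cst.
- by apply: cvg_geometric; rewrite ger0_norm.
Qed.

End absolutely_monotonic_taylor.

(** * Expansion of a completely monotonic function as a Dirichlet series *)

Section completely_monotonic_dirichlet.
Context {R : realType}.
Variable g : R -> R.
Hypothesis cm : completely_monotonic g.

Lemma completely_monotonic_ge0 (x : R) : 0 < x -> 0 <= g x.
Proof. by move=> x0; have := cm.2 0%N x x0; rewrite expr0 mul1r. Qed.

Lemma completely_monotonic_le (x y : R) : 0 < x -> x <= y -> g y <= g x.
Proof.
move=> x0 xy; rewrite -lerN2.
have pos z : x <= z < y + 1 -> 0 < z by move=> /andP[+ _]; exact: lt_le_trans.
have y1 : y < y + 1 by rewrite ltrDl.
apply: (@ge0_is_derive_le R (fun z => - g z) (fun z => - derive1 g z) x (y + 1)) => //.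
  move=> z /pos z0; apply: is_deriveN; rewrite derive1E; apply: derivableP.
  exact: (cm.1 0%N).
by move=> z /pos z0; have := cm.2 1%N z z0; rewrite expr1 mulN1r.
Qed.

(** The reflection [h |-> a - h] contributes a factor -1 to each derivative, which cancels the
    alternating signs. *)
Lemma completely_monotonic_family (a : R) :
  absolutely_monotonic_family
    (fun k h => (-1) ^+ k * derive1n k g (a - h)) a.
Proof.
split=> k h; last first.
  by move=> /andP[_ ha]; apply cm.2; rewrite subr_gt0.
move=> ha; have ah0 : 0 < a - h by rewrite subr_gt0.
have h1 : is_derive (a - h) 1 (derive1n k g) (derive1n k.+1 g (a - h)).
  by rewrite derive1nS derive1E; apply: derivableP; exact: cm.1.
have h2 : is_derive h 1 (fun y : R => a - y) (-1).
  have := is_deriveB (is_derive_cst a h 1) (is_derive_id h 1).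
  by rewrite sub0r.
have h3 := @is_derive1_comp _ (derive1n k g) (fun y => a - y) _ _ _ h1 h2.
have := is_deriveZ ((-1) ^+ k) h3.
congr (is_derive _ _ _ _).
by rewrite /GRing.scale/= exprS; ring.
Qed.

(** The mass at [k / a] of the discrete measure that approximates the Bernstein measure of [g]. *)
Definition dirichlet_weight (a : R) (k : nat) : R :=
  (-1) ^+ k * derive1n k g a / k`!%:R * a ^+ k.

Lemma dirichlet_weight_ge0 a k : 0 < a -> 0 <= dirichlet_weight a k.
Proof.
by move=> a0; rewrite /dirichlet_weight mulr_ge0 ?exprn_ge0 ?(ltW a0)// divr_ge0// cm.2.
Qed.

Lemma dirichlet_seriesE (a x : R) : 0 < a -> 0 < x ->
  (\sum_(0 <= k <oo) (dirichlet_weight a k * expR (- (x * (k%:R / a))))%:E =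
   (g (a * (1 - expR (- (x / a)))))%:E)%E.
Proof.
move=> a0 x0.
(* This increment lies in [[0, a)], where the Taylor series converges, and its k-th power is
   [a ^ k * expR (- (x * k / a))]. *)
have e1 : 0 <= a * expR (- (x / a)) < a.
  by rewrite mulr_ge0 ?expR_ge0 ?(ltW a0)//= gtr_pMr// expR_lt1 oppr_lt0 divr_gt0.
have := absolutely_monotonic_taylor_cvg (completely_monotonic_family a) e1.
rewrite expr0 mul1r mulrBr mulr1 => tc.
apply/cvg_lim => //; apply: cvg_EFin; first by apply: nearW => n; rewrite sumEFin.
apply: cvg_trans tc; apply: near_eq_cvg; apply: nearW => n /=.
rewrite /taylor_poly horner_poly sumEFin/= big_mkord; apply: eq_bigr => i _.
rewrite subr0 /dirichlet_weight exprMn -expRM_natr mulrA; congr (_ * expR _).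
by field; rewrite gt_eqF.
Qed.

End completely_monotonic_dirichlet.

Section dirichlet_argument.
Context {R : realType}.

(** With [y = x / a], both bounds come from [1 + z <= expR z], taken at [- y] for the upper one and
    at [y] for the lower one. *)
Lemma dirichlet_argument_bounds (a x : R) : 0 < a -> 0 < x ->
  x / (1 + x / a) <= a * (1 - expR (- (x / a))) <= x.
Proof.
move=> a0 x0; set y := x / a; have y0 : 0 < y by rewrite divr_gt0.
have -> : x = a * y by rewrite /y mulrC divfK ?gt_eqF.
rewrite -mulrA !ler_pM2l//; apply/andP; split; last first.
  by have := @expR_ge1Dx R (- y); lra.
have y1 : 0 < 1 + y by rewrite addr_gt0.
rewrite expRN lerBrDr -lerBrDl.
have -> : 1 - y / (1 + y) = (1 + y)^-1 by field; rewrite gt_eqF.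
by rewrite lef_pV2 ?posrE ?expR_gt0// expR_ge1Dx.
Qed.

Lemma dirichlet_argument_cvg (x : R) : 0 < x ->
  n.+1%:R * (1 - expR (- (x / n.+1%:R))) @[n --> \oo] --> x.
Proof.
move=> x0; apply: (@squeeze_cvgr _ _ _ _ (fun n => x / (1 + x / n.+1%:R)) (cst x)).
- by apply: nearW => n; exact: dirichlet_argument_bounds.
- rewrite -[X in _ --> X]divr1; apply: cvgM; first exact: cvg_cst.
  apply: cvgV; first by [].
  rewrite -[X in _ --> X]addr0; apply: cvgD; first exact: cvg_cst.
  rewrite -(mulr0 x); apply: cvgM; [exact: cvg_cst|exact: cvg_harmonic].
- exact: cvg_cst.
Qed.

End dirichlet_argument.

(** * Helly selection *)

Section helly_selection.
Context {R : realType}.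

(** Compactness of [[-M, M]] gives a cluster point, and an ultrafilter converges to each of its
    cluster points. *)
Lemma ultra_bounded_cvg (U : set_system nat) (u : nat -> R) (M : R) :
  UltraFilter U -> (forall n, `|u n| <= M) -> exists l : R, u @ U --> l.
Proof.
move=> UU uM; have [|p [_ pcl]] := @segment_compact R (- M) M (u @ U) _.
  by apply: (@filterE _ U) => n /=; rewrite in_itv/= -ler_norml.
exists p => A pA; have [//|UA] := in_ultra_setVsetC (u @^-1` A) UU.
have [] := pcl (~` A) A => //.
by move=> x [].
Qed.

(* Along an ultrafilter all the sequences [F n q] converge; [phi m] is picked in
   the intersection of the finitely many members of the ultrafilter that control
   the first [m] rationals, which replaces the diagonal extraction. *)
Lemma rational_diagonal_cvg (F : nat -> R -> R) (C : R -> R) :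
  (forall n t, `|F n t| <= C t) ->
  exists (H : rat -> R) (phi : nat -> nat),
    (forall m, (m <= phi m)%N) /\
    forall q, F (phi m) (ratr q) @[m --> \oo] --> H q.
Proof.
move=> FC; have [U [UU oU]] := @ultraFilterLemma nat \oo _.
have /choice[H HU] q : exists l : R, (fun n => F n (ratr q)) @ U --> l.
  by apply: ultra_bounded_cvg => n; exact: FC.
(* Rationals are enumerated by their codes; an index that codes no rational imposes no condition. *)
have /choice[phi phiH] m : exists n, (m <= n)%N /\ forall i : 'I_m,
    if unpickle i is Some q then `|H q - F n (ratr q)| < m.+1%:R^-1 else true.
  apply: (@filter_ex _ U); apply: filterI.
    by apply: oU; exact: nbhs_infty_ge.
  apply: filter_forall => i.
  case: (unpickle i) => [q|]; last exact: filterE.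
  by have /cvgrPdist_lt := HU q; apply; rewrite invr_gt0.
exists H, phi; split=> [m|q]; first by case: (phiH m).
apply/cvgrPdist_lt => e e0.
near=> m; have qm : (pickle q < m)%N by near: m; exact: nbhs_infty_gt.
have := (phiH m).2 (Ordinal qm); rewrite /= pickleK => /lt_trans; apply.
by near: m; exact: near_infty_natSinv_lt (PosNum e0).
Unshelve. all: by end_near. Qed.

(* [G] is the right-continuous regularization of the limit over the rationals,
   whence the asymmetry of the two eventual bounds. *)
Lemma helly_selection (F : nat -> R -> R) (C : R -> R) :
  (forall n, nondecreasing_fun (F n)) -> (forall n t, `|F n t| <= C t) ->
  exists (G : R -> R) (phi : nat -> nat),
    [/\ forall m, (m <= phi m)%N, nondecreasing_fun G, right_continuous G,
        forall t e, 0 < e -> \forall m \near \oo, F (phi m) t <= G t + e &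
        forall s t e, s < t -> 0 < e ->
          \forall m \near \oo, G s - e <= F (phi m) t].
Proof.
move=> ndF FC; have [H [phi [phim phiH]]] := rational_diagonal_cvg FC.
have ndH p q : p <= q -> H p <= H q.
  move=> pq; apply: (ler_cvg_to (phiH p) (phiH q)).
  by apply: nearW => m; apply: ndF; rewrite ler_rat.
pose S (t : R) := [set H q | q in [set q : rat | t < ratr q]].
pose G (t : R) := inf (S t).
have S0 t : S t !=set0.
  have [q] : exists q, ratr q \in `]t, t + 1[ by apply: rat_in_itvoo; rewrite ltrDl.
  by rewrite in_itv/= => /andP[tq _]; exists (H q), q.
have lbS t : has_lbound (S t).
  have [p] : exists p, ratr p \in `]t - 1, t[ by apply: rat_in_itvoo; rewrite gtrBl.
  rewrite in_itv/= => /andP[_ pt]; exists (H p) => _ [q /= tq <-].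
  by apply: ndH; rewrite -(ler_rat R) ltW// (lt_trans pt).
have GH t q : t < ratr q -> G t <= H q.
  by move=> tq; apply: ge_inf => //; exists q.
have Gadh t e : 0 < e -> exists2 q, t < ratr q & H q < G t + e.
  move=> e0; have [_ [q tq <-] ?] := inf_adherent e0 (conj (S0 t) (lbS t)).
  by exists q.
have ndG : nondecreasing_fun G.
  move=> s t st; apply: lb_le_inf => // _ [q /= tq <-].
  by apply: GH; rewrite (le_lt_trans st).
exists G, phi; split => //.
- move=> t; apply/cvgrPdist_lt => e e0.
  have [q tq Hq] := Gadh t e e0.
  near=> s; have ts : t < s by [].
  rewrite ler0_norm ?subr_le0 ?ndG// ?ltW// opprB ltrBlDl.
  apply: le_lt_trans Hq; apply: GH.
  by near: s; exact: nbhs_right_lt.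
- move=> t e e0; have e20 : 0 < e / 2 by rewrite divr_gt0.
  have [q tq Hq] := Gadh t _ e20.
  have /cvgrPdist_lt/(_ _ e20) := phiH q.
  apply: filterS => m; rewrite distrC => /ltr_distlDr => h.
  rewrite (le_trans (ndF _ _ _ (ltW tq)))//.
  by rewrite (le_trans (ltW h))// [leRHS](_ : _ = G t + e / 2 + e / 2) ?lerD2r ?ltW//
    -addrA -splitr.
- move=> s t e st e0; have [q] := rat_in_itvoo st.
  rewrite in_itv/= => /andP[sq qt].
  have /cvgrPdist_lt/(_ _ e0) := phiH q.
  apply: filterS => m /ltr_distlDr h.
  rewrite lerBlDr (le_trans (GH _ _ sq))// (le_trans (ltW h))// lerD2r.
  exact/ndF/ltW.
Unshelve. all: by end_near. Qed.

(** The lower bound at [t] only involves [G s] with [s < t]; left continuity of [G] at [t] closes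
    this gap. *)
Lemma helly_selection_cvg (F : nat -> R -> R) (G : R -> R) (t : R) :
  nondecreasing_fun G -> right_continuous G -> ~ discontinuity G t ->
  (forall t e, 0 < e -> \forall m \near \oo, F m t <= G t + e) ->
  (forall s t e, s < t -> 0 < e -> \forall m \near \oo, G s - e <= F m t) ->
  F m t @[m --> \oo] --> G t.
Proof.
move=> ndG rcG dG up lo.
(* Monotonicity provides a left limit; were it different from the right limit [G t], the point [t]
   would be a jump. *)
have Gl : G x @[x --> t^'-] --> G t.
  have cl : cvg (G x @[x --> t^'-]).
    apply: nondecreasing_at_left_is_cvgr.
    - by apply: nearW => s x y _ _; exact: ndG.
    - by near=> s; exists (G t) => _ [x /= + <-]; rewrite in_itv/= => /andP[_ /ltW /ndG].
  have cr := rcG t.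
  apply: contrapT => nGl; apply: dG; split => //.
  - by apply/cvg_ex; exists (G t).
  - apply/eqP => lr; apply: nGl; rewrite -(cvg_lim _ cr)// -lr.
    exact: cl.
apply/cvgrPdist_le => e e0; have e20 : 0 < e / 2 by rewrite divr_gt0.
have [s st Gs] : exists2 s, s < t & G t - e / 2 <= G s.
  move/cvgrPdist_lt : Gl => /(_ _ e20) Gl.
  near t^'- => s; exists s; first by near: s; exact: nbhs_left_lt.
  have : `|G t - G s| < e / 2 by near: s.
  by move=> /ltr_distlDr /ltW; rewrite lerBlDr.
near=> m; rewrite distrC ler_distl; apply/andP; split.
  have : G s - e / 2 <= F m t by near: m; exact: lo.
  by apply: le_trans; rewrite lerBrDr (le_trans _ Gs)// [e in leLHS]splitr; lra.
by near: m; exact: up.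
Unshelve. all: by end_near. Qed.

End helly_selection.

(** * Bernstein's theorem *)

Section exponential_integrals.
Context {R : realType}.
Implicit Types a b c x y t : R.

Lemma is_derive_expRM c t :
  is_derive t 1 (fun t : R => expR (c * t)) (c * expR (c * t)).
Proof.
have h : is_derive t 1 (fun t : R => c * t) c.
  by have := is_deriveZ c (is_derive_id t 1); rewrite /GRing.scale/= mulr1.
have := @is_derive1_comp _ expR (fun t => c * t) _ _ _ (is_derive_expR _) h.
by rewrite mulrC.
Qed.

Lemma continuous_expRM c : continuous (fun t : R => expR (c * t)).
Proof.
move=> t; apply: differentiable_continuous; apply/derivable1_diffP.
by case: (is_derive_expRM c t).
Qed.

Lemma continuous_expRMN x : continuous (fun t : R => expR (- (x * t))).
Proof.
rewrite (_ : (fun _ => _) = (fun t => expR (- x * t))); first exact: continuous_expRM.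
by apply/funext => t; rewrite mulNr.
Qed.

Lemma cvg_expRM_pinfty x : 0 < x -> expR (- (x * t)) @[t --> +oo] --> 0.
Proof.
move=> x0.
apply: (@cvg_comp _ _ _ (fun t => x * t) (fun t => expR (- t)) _ (pinfty_nbhs R));
  last exact: cvgr_expR.
apply/cvgryPge => M; near=> t.
by rewrite mulrC -ler_pdivrMr//; near: t; exact: nbhs_pinfty_ge.
Unshelve. all: by end_near. Qed.

(** Writing an exponential as the integral of its tail turns a Laplace transform into an integral of
    the cumulative function. *)
Lemma integral_exp_tail x a : 0 < x ->
  (\int[lebesgue_measure]_(t in `[a, +oo[) (x * expR (- (x * t)))%:E =
   (expR (- (x * a)))%:E)%E.
Proof.
move=> x0.
have dF t : is_derive t 1 (fun t : R => - expR (- (x * t))) (x * expR (- (x * t))).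
  have := is_deriveN (is_derive_expRM (- x) t).
  congr (is_derive _ _ _ _); last by rewrite !mulNr opprK.
  by apply/funext => s; rewrite -mulNr.
rewrite (@ge0_continuous_FTC2y _ _ (fun t => - expR (- (x * t))) _ 0).
- by rewrite sub0e -EFinN opprK.
- by move=> t _; rewrite mulr_ge0 ?ltW ?expR_gt0.
- apply: continuous_subspaceT => t; apply: cvgM; first exact: cvg_cst.
  exact: continuous_expRMN.
- by rewrite -oppr0; apply: cvgN; exact: cvg_expRM_pinfty.
- by move=> t _; case: (dF t).
- by apply: cvg_at_right_filter; apply: cvgN; exact: continuous_expRMN.
- by move=> t _; rewrite derive1E (@derive_val _ _ _ _ _ _ _ (dF t)).
Qed.

Lemma measurable_expRM c (D : set R) : measurable_fun D (fun t : R => expR (c * t)).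
Proof.
apply: (measurable_funS measurableT) => //.
by apply: continuous_measurable_fun; exact: continuous_expRM.
Qed.

Lemma measurable_expRMN x (D : set R) :
  measurable_fun D (fun t : R => expR (- (x * t))).
Proof.
rewrite (_ : (fun _ => _) = (fun t => expR (- x * t))); first exact: measurable_expRM.
by apply/funext => t; rewrite mulNr.
Qed.

End exponential_integrals.

(** * Discrete measures and their cumulative functions *)

Section step_function.
Context {R : realType}.
Variables p a : nat -> R.
Hypothesis p0 : forall k, 0 <= p k.
Hypothesis a0 : forall k, 0 <= a k.
Local Open Scope ereal_scope.

(** The Laplace transform of the measure with mass [p k] at [a k]; [step_sum] is the cumulative
    function of that measure. *)
Definition dirichlet_sum (x : R) : \bar R :=
  \sum_(0 <= k <oo) (p k * expR (- (x * a k)))%:E.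

Definition step_sum (t : R) : \bar R := \sum_(0 <= k <oo) (p k * (a k <= t)%R%:R)%:E.

Lemma step_sum_ge0 t : 0 <= step_sum t.
Proof. by apply: nneseries_ge0 => k _ _; rewrite lee_fin mulr_ge0. Qed.

Lemma step_sum_nd s t : (s <= t)%R -> step_sum s <= step_sum t.
Proof.
move=> st; apply: lee_nneseries => k; first by rewrite lee_fin mulr_ge0.
move=> _; rewrite lee_fin ler_wpM2l// ler_nat.
by case: (leP (a k) s) => // as_; rewrite (le_trans as_ st).
Qed.

(** A Chernoff bound: the indicator of [a k <= t] is at most [expR (x * (t - a k))]. *)
Lemma step_sum_le x t : (0 < x)%R ->
  step_sum t <= (expR (x * t))%:E * dirichlet_sum x.
Proof.
move=> x0; rewrite /dirichlet_sum -nneseriesZl; last first.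
  by move=> k _; rewrite lee_fin mulr_ge0 ?expR_ge0.
apply: lee_nneseries => k; first by rewrite lee_fin mulr_ge0.
move=> _; rewrite -EFinM lee_fin mulrCA ler_wpM2l// -expRD -mulrBr.
case: (leP (a k) t) => akt; last by rewrite expR_ge0.
rewrite (le_trans _ (expR_ge1Dx _))// lerDl mulr_ge0 ?subr_ge0//.
exact: ltW.
Qed.

(** Integration by parts, carried out term by term: the k-th term of [step_sum] integrates to the
    exponential tail beyond [a k]. *)
Lemma integral_step_sum x : (0 < x)%R ->
  \int[lebesgue_measure]_(t in `[0%R, +oo[)
    ((x * expR (- (x * t)))%:E * step_sum t) = dirichlet_sum x.
Proof.
move=> x0.
under eq_integral => t _.
  rewrite /step_sum -nneseriesZl; last by move=> k _; rewrite lee_fin mulr_ge0.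
  over.
rewrite integral_nneseries//=; last 2 first.
- move=> k; apply/measurable_EFinP; apply: measurable_funM.
    by apply: measurable_funM => //; exact: measurable_expRMN.
  apply: measurable_funM => //.
  apply: nondecreasing_measurable => // s t st; rewrite ler_nat.
  by case: (leP (a k) s) => // as_; rewrite (le_trans as_ st).
- by move=> k t _; rewrite lee_fin !mulr_ge0 ?expR_ge0 ?(ltW x0).
congr (limn _); apply/funext => n; apply: eq_bigr => k _.
rewrite EFinM -integral_exp_tail//.
rewrite -ge0_integralZl//; last 3 first.
- apply/measurable_EFinP; apply: measurable_funM => //; exact: measurable_expRMN.
- by move=> t _; rewrite lee_fin mulr_ge0 ?expR_ge0 ?(ltW x0).
- by rewrite lee_fin.
rewrite [LHS]integral_mkcond [RHS]integral_mkcond; apply: eq_integral => t _.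
rewrite /patch/= !mem_setE !in_itv/= !andbT.
case: (leP (a k) t) => akt; first by rewrite (le_trans (a0 k) akt) mulr1 muleC.
by rewrite mulr0 mule0; case: ifP.
Qed.

End step_function.

(** * Passage to the limit in the cumulative functions *)

Section cumulative_function.
Context {R : realType}.
Local Notation leb := lebesgue_measure.

(** A monotone function has countably many jumps on each [](- n), n[], hence on the line, and
    countable sets are null. *)
Lemma negligible_discontinuity (G : R -> R) : nondecreasing_fun G ->
  {ae (leb : set (measurableTypeR R) -> \bar R), forall t, ~ discontinuity G t}.
Proof.
move=> ndG; set D := [set t | discontinuity G t].
have Dc : countable D.
  apply: (@sub_countable _ _ _ (\bigcup_n
    [set x | (x \in `](- n%:R), n%:R[) /\ discontinuity G x])).
    apply: subset_card_le => x Dx; exists (Num.bound `|x|) => //=; split => //.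
    by rewrite in_itv/= -ltr_norml archi_boundP.
  apply: bigcup_countable => // n _; apply: discontinuity_countable.
  by move=> x y _ _; exact: ndG.
exists D; split.
- exact: countable_measurable.
- exact: countable_lebesgue_measure0.
- by move=> t /= /contrapT.
Qed.

(** This is Bernstein's formula after integration by parts. In this form the limit is one of
    functions under a Lebesgue integral, and weak convergence of measures is avoided. *)
Lemma completely_monotonic_cumulative (g : R -> R) : completely_monotonic g ->
  exists G : R -> R, [/\ nondecreasing_fun G, right_continuous G, 0 <= G 0 &
    forall x, 0 < x ->
      (\int[leb]_(t in `[0%R, +oo[) (x * expR (- (x * t)) * G t)%:E = (g x)%:E)%E].
Proof.
move=> cm.
pose p n := dirichlet_weight g n.+1%:R; pose a (n k : nat) : R := k%:R / n.+1%:R.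
have p0 n k : 0 <= p n k by exact: dirichlet_weight_ge0.
have a0 n k : 0 <= a n k by rewrite divr_ge0.
pose ga n x := g (n.+1%:R * (1 - expR (- (x / n.+1%:R)))).
have pE n x : 0 < x -> dirichlet_sum (p n) (a n) x = (ga n x)%:E.
  by move=> x0; exact: dirichlet_seriesE.
(* As [n.+1 >= 1], the argument of [g] in [ga n y] is at least [y / (1 + y)]. This makes the bounds
   on the cumulative functions independent of [n]. *)
have ga_le n y : 0 < y -> ga n y <= g (y / (1 + y)).
  move=> y0; rewrite /ga; apply: (completely_monotonic_le cm).
    by rewrite divr_gt0 ?addr_gt0.
  have /andP[+ _] := @dirichlet_argument_bounds R n.+1%:R y ltac:(by []) y0.
  apply: le_trans; rewrite ler_pM2l// lef_pV2 ?posrE ?addr_gt0 ?divr_gt0//.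
  by rewrite lerD2l ler_pdivrMr// ler_peMr ?ler1n// ltW.
pose F n t := fine (step_sum (p n) (a n) t).
have S_le n y t : 0 < y -> (step_sum (p n) (a n) t <= (expR (y * t) * g (y / (1 + y)))%:E)%E.
  move=> y0; rewrite (le_trans (step_sum_le (a n) (p0 n) t y0))//.
  by rewrite pE// -EFinM lee_fin ler_wpM2l ?expR_ge0// ga_le.
have S_fin n t : step_sum (p n) (a n) t \is a fin_num.
  rewrite ge0_fin_numE ?step_sum_ge0//.
  by rewrite (le_lt_trans (S_le n 1 t _)) ?ltry.
have FE n t : (F n t)%:E = step_sum (p n) (a n) t by rewrite /F fineK.
have F0 n t : 0 <= F n t by rewrite -lee_fin FE step_sum_ge0.
have F_le n y t : 0 < y -> F n t <= expR (y * t) * g (y / (1 + y)).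
  by move=> y0; rewrite -lee_fin FE; exact: S_le.
have ndF n : nondecreasing_fun (F n).
  by move=> s t st; rewrite -lee_fin !FE; exact: step_sum_nd.
have [G [phi [phim ndG rcG up lo]]] := @helly_selection R F
  (fun t => expR (1 * t) * g (1 / (1 + 1))) ndF
  ltac:(by move=> n t; rewrite ger0_norm// F_le).
exists G; split => //.
  apply/ler_addgt0Pr => e e0; have [N _ /(_ N)] := up 0 e e0.
  by move=> /(_ (leqnn N)); exact: le_trans.
(* With [y = x / 2], the growth [expR (y * t)] of the cumulative functions uses up half of
   [expR (- (x * t))]; the other half gives an integrable majorant. *)
move=> x x0; pose y := x / 2; have y0 : 0 < y by rewrite divr_gt0.
pose c := g (y / (1 + y)).
have c0 : 0 <= c by apply: completely_monotonic_ge0 => //; rewrite divr_gt0 ?addr_gt0.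
pose f m (t : R) := (x * expR (- (x * t)) * F (phi m) t)%:E.
have mnd (H : R -> R) : nondecreasing_fun H ->
    measurable_fun (`[0%R, +oo[%classic : set R)
      (fun t : R => (x * expR (- (x * t)) * H t)%:E).
  move=> ndH; apply/measurable_EFinP; apply: measurable_funM.
    by apply: measurable_funM => //; exact: measurable_expRMN.
  exact: nondecreasing_measurable.
have int_dom : (leb : measure (measurableTypeR R) R).-integrable (`[0%R, +oo[%classic : set R)
    (fun t : R => (2 * c)%:E * (y * expR (- (y * t)))%:E)%E.
  apply: integrableZl => //; apply/integrableP; split.
    by apply/measurable_EFinP; apply: measurable_funM => //; exact: measurable_expRMN.
  rewrite (_ : (\int[_]_(_ in _) _)%E = (expR (- (y * 0)))%:E) ?ltry//.
  rewrite -(integral_exp_tail 0 y0); apply: eq_integral => t _.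
  by rewrite /= ger0_norm// mulr_ge0 ?expR_ge0 ?(ltW y0).
have f_cvg : {ae (leb : set (measurableTypeR R) -> \bar R), forall t,
    (`[0%R, +oo[%classic : set R) t ->
    f m t @[m --> \oo] --> (x * expR (- (x * t)) * G t)%:E}.
  have := negligible_discontinuity ndG.
  apply: filterS.
    exact: (ae_filter_ringOfSetsType (leb : measure (measurableTypeR R) R)).
  move=> t dt _.
  apply: cvg_EFin; first exact: nearW.
  by apply: cvgM; [exact: cvg_cst|exact: helly_selection_cvg ndG rcG dt up lo].
have f_dom m t : (`[0%R, +oo[%classic : set R) t ->
    (`|f m t| <= (2 * c)%:E * (y * expR (- (y * t)))%:E)%E.
  rewrite /= in_itv/= andbT => t0.
  rewrite /f -EFinM lee_fin ger0_norm; last by rewrite !mulr_ge0 ?expR_ge0 ?(ltW x0).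
  apply: (@le_trans _ _ (x * expR (- (x * t)) * (expR (y * t) * c))).
    by rewrite ler_wpM2l ?mulr_ge0 ?expR_ge0 ?(ltW x0) ?F_le.
  rewrite mulrACA -mulrA (mulrA (expR _)) -expRD.
  have -> : y * t - x * t = - (y * t) by rewrite /y; field.
  by rewrite (_ : x * _ = 2 * c * (y * expR (- (y * t))))// /y; field.
have mD : measurable (`[0%R, +oo[%classic : set (measurableTypeR R)) by [].
have [_ _ dct] := @dominated_convergence _ (measurableTypeR R) R leb _ mD f
  (fun t => (x * expR (- (x * t)) * G t)%:E) _ (fun m => mnd _ (ndF (phi m)))
  (mnd _ ndG) f_cvg int_dom (@aeW _ (measurableTypeR R) R leb _ (fun t m => @f_dom m t)).
(* The same integrals are the values [ga (phi m) x], which tend to [g x] by continuity of [g] at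
   [x]. *)
apply: (cvg_unique _ dct) => //.
have -> : [sequence (\int[leb]_(t in `[0%R, +oo[) f m t)%E]_m = fun m => (ga (phi m) x)%:E.
  apply/funext => m; rewrite /= -pE// -integral_step_sum//.
  by apply: eq_integral => t _; rewrite /f EFinM FE.
apply: cvg_EFin; first exact: nearW.
have phioo : phi @ \oo --> \oo.
  apply/cvgnyPge => N; near=> m; rewrite (leq_trans _ (phim m))//.
  by near: m; exact: nbhs_infty_ge.
apply: (cvg_comp phi (fun n => ga n x) phioo).
apply: (cvg_comp _ g (dirichlet_argument_cvg x0)).
have /derivable1_diffP/differentiable_continuous := cm.1 0%N x x0.
exact.
Unshelve. all: by end_near. Qed.


End cumulative_function.

(** * Tonelli's theorem on triangles and rectangles *)

Section tonelli.
Context {R : realType}.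
Local Open Scope ereal_scope.
Variables m1 m2 : {sigma_finite_measure set (measurableTypeR R) -> \bar R}.
Variables h k : R -> R.
Hypothesis h0 : forall s, (0 <= h s)%R.
Hypothesis k0 : forall t, (0 <= k t)%R.
Hypothesis mh : measurable_fun setT h.
Hypothesis mk : measurable_fun setT k.

Let T := measurableTypeR R.

Let measurable_fun_bool_indic (b : T * T -> bool) : measurable_fun setT b ->
  measurable_fun setT (fun z => (b z)%:R : R).
Proof.
move=> mb; have mB : measurable (b @^-1` [set true]).
  by rewrite -[X in measurable X]setTI; exact: mb.
rewrite (_ : (fun _ => _) = \1_(b @^-1` [set true])); first exact: measurable_indic.
apply/funext => z; rewrite indicE; case: (boolP (b z)) => bz.
  by rewrite mem_set.
by rewrite memNset//= => bt; rewrite bt in bz.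
Qed.

(** Both sides integrate [h s * k t] over [0 < s <= t]. This serves to undo the integration by parts
    in Bernstein's theorem and to exchange the two integrals of the representation. *)
Lemma tonelli_triangle :
  \int[m1]_(s in `]0%R, +oo[) ((h s)%:E * \int[m2]_(t in `[s, +oo[) (k t)%:E) =
  \int[m2]_(t in `]0%R, +oo[) ((k t)%:E * \int[m1]_(s in `]0%R, t]) (h s)%:E).
Proof.
pose f (z : T * T) : \bar R :=
  (h z.1 * k z.2 * ((0 < z.1)%R && (z.1 <= z.2)%R)%:R)%:E.
have f0 z : 0 <= f z by rewrite lee_fin !mulr_ge0.
have mf : measurable_fun setT f.
  apply/measurable_EFinP; apply: measurable_funM.
    by apply: measurable_funM; apply: measurableT_comp.
  apply: measurable_fun_bool_indic; apply: measurable_and.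
    by apply: measurable_fun_ltr => //; exact: measurable_fst.
  by apply: measurable_fun_ler; [exact: measurable_fst|exact: measurable_snd].
transitivity (\int[m1]_s \int[m2]_t f (s, t)).
  rewrite integral_mkcond; apply: eq_integral => s _; rewrite patchE.
  case: ifPn; rewrite mem_setE in_itv/= andbT => s0.
    rewrite -ge0_integralZl_EFin//.
    - rewrite integral_mkcond; apply: eq_integral => t _; rewrite patchE mem_setE.
      rewrite in_itv/= andbT /f/= s0/=; case: ifP => _; last by rewrite mulr0.
      by rewrite mulr1.
    - by move=> t _; rewrite lee_fin.
    - by apply/measurable_EFinP; exact: measurable_funS mk.
  by rewrite integral0_eq// => t _; rewrite /f/= (negbTE s0)/= mulr0.
rewrite (fubini_tonelli _ mf f0).
rewrite [RHS]integral_mkcond; apply: eq_integral => t _; rewrite patchE.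
case: ifPn; rewrite mem_setE in_itv/= andbT => t0.
  rewrite -ge0_integralZl_EFin//.
  - rewrite [RHS]integral_mkcond; apply: eq_integral => s _; rewrite patchE mem_setE.
    rewrite in_itv/= /f/=; case: ifP => _; last by rewrite mulr0.
    by rewrite mulr1 mulrC.
  - by move=> s _; rewrite lee_fin.
  - by apply/measurable_EFinP; exact: measurable_funS mh.
rewrite integral0_eq// => s _; rewrite /f/=.
case: (ltP 0%R s) => //= s0; last by rewrite mulr0.
case: (leP s t) => st; last by rewrite mulr0.
by rewrite (lt_le_trans s0 st) in t0.
Qed.

End tonelli.

Section tonelli_rectangle.
Context {R : realType}.
Local Open Scope ereal_scope.
Let T := measurableTypeR R.
Variables m1 m2 : {sigma_finite_measure set T -> \bar R}.

Lemma tonelli_rectangle (f : T * T -> \bar R) (D1 D2 : set T) :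
  measurable D1 -> measurable D2 -> measurable_fun setT f -> (forall z, 0 <= f z) ->
  \int[m1]_(s in D1) \int[m2]_(t in D2) f (s, t) =
  \int[m2]_(t in D2) \int[m1]_(s in D1) f (s, t).
Proof.
move=> mD1 mD2 mf f0.
pose F := f \_ (D1 `*` D2).
have mF : measurable_fun setT F.
  apply/(measurable_restrictT f); first exact: measurableX.
  exact: measurable_funS mf.
have F0 z : 0 <= F z by rewrite /F patchE; case: ifP.
transitivity (\int[m1]_s \int[m2]_t F (s, t)).
  rewrite integral_mkcond; apply: eq_integral => s _; rewrite patchE.
  case: ifPn => [/set_mem Ds|/negP Ds].
    rewrite integral_mkcond; apply: eq_integral => t _; rewrite /F !patchE.
    case: ifPn => [/set_mem Dt|/negP Dt]; first by rewrite mem_set.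
    by rewrite memNset// => -[_ /mem_set].
  by rewrite integral0_eq// => t _; rewrite /F patchE memNset// => -[/mem_set].
rewrite (fubini_tonelli _ mF F0).
rewrite [RHS]integral_mkcond; apply: eq_integral => t _; rewrite patchE.
case: ifPn => [/set_mem Dt|/negP Dt].
  rewrite [RHS]integral_mkcond; apply: eq_integral => s _; rewrite /F !patchE.
  case: ifPn => [/set_mem [] Ds _|/negP Ds]; first by rewrite mem_set.
  by rewrite memNset// => Ds'; apply: Ds; rewrite mem_set.
by rewrite integral0_eq// => s _; rewrite /F patchE memNset// => -[_ /mem_set].
Qed.

(** The tail integral is the section integral of [k t] restricted to the half-plane [s <= t]. *)
Lemma measurable_integral_tail (k : R -> R) : (forall t, 0 <= k t)%R ->
  measurable_fun setT k ->
  measurable_fun [set: T] (fun s : T => \int[m2]_(t in `[s : R, +oo[) (k t)%:E).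
Proof.
move=> k0 mk.
have mA : measurable [set z : T * T | (z.1 <= z.2)%R].
  rewrite -[X in measurable X]setTI.
  rewrite (_ : [set _ | _] = (fun z : T * T => (z.1 <= z.2)%R) @^-1` [set true])//.
  exact: measurable_fun_ler.
pose f := (fun z : T * T => (k z.2)%:E) \_ [set z : T * T | (z.1 <= z.2)%R].
have mf : measurable_fun setT f.
  have mk2 : measurable_fun setT (fun z : T * T => (k z.2)%:E).
    by apply/measurable_EFinP; apply: measurableT_comp.
  apply/(measurable_restrictT (fun z : T * T => (k z.2)%:E)) => //.
  exact: measurable_funS mk2.
have f0 z : 0 <= f z by rewrite /f patchE; case: ifP => // _; rewrite lee_fin.
rewrite [X in measurable_fun _ X](_ : _ = fubini_F m2 f).
  exact: (@measurable_fun_fubini_tonelli_F _ _ T T R m2 f mf f0).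
apply/funext => s; rewrite /fubini_F [LHS]integral_mkcond. apply: eq_integral => t _.
rewrite /f !patchE mem_setE in_itv/= andbT; congr (if _ then _ else _).
by apply/idP/idP => [st|/set_mem//]; rewrite mem_set.
Qed.

End tonelli_rectangle.

(** * From the cumulative function to the Bernstein measure *)

Section bernstein.
Context {R : realType}.
Local Notation leb := (@lebesgue_measure R).

(** The measure is the Lebesgue-Stieltjes measure of [G] restricted to (0, oo). Splitting [G] as
    [G 0 + (G - G 0)] makes the first term the constant, that is, the mass at 0. *)
Theorem bernstein (g : R -> R) : completely_monotonic g ->
  exists (c : R) (mu : {measure set (measurableTypeR R) -> \bar R}),
    [/\ 0 <= c, measure_on_pos mu &
        forall x, 0 < x ->
          ((g x)%:E = c%:E + \int[mu]_(s in `]0%R, +oo[) (expR (- (x * s)))%:E)%E].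
Proof.
move=> /completely_monotonic_cumulative[G [ndG rcG G0 gE]].
pose Gc : cumulative R R := HB.pack G (isCumulative.Build R _ R G ndG rcG).
pose m : {sigma_finite_measure set (measurableTypeR R) -> \bar R} :=
  lebesgue_stieltjes_measure Gc.
have mG t : 0 < t -> m `]0, t]%classic = (G t - G 0)%:E.
  move=> t0; rewrite /m /= /lebesgue_stieltjes_measure /measure_extension.
  rewrite measurable_mu_extE//=; last exact: is_ocitv.
  by rewrite wlength_itv_bnd ?(ltW t0).
have mpos : measurable (`]0%R, +oo[%classic : set (measurableTypeR R)) by [].
exists (G 0), (mrestr m mpos); split => //.
  by rewrite /measure_on_pos /= /mrestr setICl measure0.
move=> x x0.
have k0 t : 0 <= x * expR (- (x * t)) by rewrite mulr_ge0 ?expR_ge0 ?(ltW x0).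
have mk (D : set R) : measurable_fun D (fun t : R => x * expR (- (x * t))).
  by apply: measurable_funM => //; exact: measurable_expRMN.
rewrite -gE// -integral_itv_obnd_cbnd; last first.
  apply/measurable_EFinP/measurable_funM; first exact: mk.
  exact: nondecreasing_measurable.
transitivity (\int[leb]_(t in `]0%R, +oo[)
    ((x * expR (- (x * t)))%:E * (G 0)%:E +
     (x * expR (- (x * t)))%:E * (G t - G 0)%:E))%E.
  by apply: eq_integral => t _; rewrite -!EFinM -EFinD -mulrDr addrCA subrr addr0.
have Gt0 t : `]0, +oo[%classic t -> 0 <= G t - G 0.
  by rewrite /= in_itv/= andbT => t0; rewrite subr_ge0 ndG// ltW.
rewrite ge0_integralD//=; last 4 first.
- by move=> t _; rewrite -EFinM lee_fin mulr_ge0 ?k0.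
- by apply/measurable_EFinP; apply: measurable_funM => //; exact: mk.
- by move=> t; rewrite inE => t0; rewrite -EFinM lee_fin mulr_ge0 ?k0 ?Gt0.
- apply/measurable_EFinP; apply: measurable_funM; first exact: mk.
  by apply: measurable_funB => //; exact: nondecreasing_measurable.
congr (_ + _)%E.
  rewrite ge0_integralZr//; last 2 first.
  - by apply/measurable_EFinP; exact: mk.
  - by move=> t _; rewrite lee_fin k0.
  rewrite integral_itv_obnd_cbnd; last by apply/measurable_EFinP; exact: mk.
  by rewrite integral_exp_tail// mulr0 oppr0 expR0 mul1e.
(* Once [G t - G 0] is read as the mass of []0, t]], exchanging the integrals leaves the exponential
   tail beyond [s]. *)
transitivity (\int[leb]_(t in `]0%R, +oo[)
    ((x * expR (- (x * t)))%:E * \int[m]_(s in `]0%R, t]) 1%:E))%E.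
  apply: eq_integral => t; rewrite mem_setE in_itv/= andbT => t0.
  by rewrite integral_cst// mul1e -(mG _ t0).
rewrite -(tonelli_triangle m leb (h := cst 1))//.
transitivity (\int[m]_(s in `]0%R, +oo[) (expR (- (x * s)))%:E)%E.
  by apply: eq_integral => s _; rewrite integral_exp_tail// mul1e.
apply: eq_measure_integral => A mA Apos.
change (m A = m (A `&` `]0, +oo[%classic)).
by rewrite setIidl.
Qed.

End bernstein.

(** * The double integral *)

Section lebesgue_scaling.
Context {R : realType}.
Local Notation leb := (@lebesgue_measure R).
Local Open Scope ereal_scope.

(** Lebesgue measure is [c] times its image under [y |-> c * y], by uniqueness, since the two agree
    on half-open intervals. *)
Lemma integral_scaling (c b : R) (f : R -> \bar R) : (0 < c)%R ->
  measurable_fun setT f -> (forall s, 0 <= f s) ->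
  \int[leb]_(s in `]0%R, (c * b)%R]) f s = c%:E * \int[leb]_(y in `]0%R, b]) f (c * y)%R.
Proof.
move=> c0 mf f0.
pose phi : measurableTypeR R -> measurableTypeR R := fun y : R => (c * y)%R.
have mphi : measurable_fun setT phi by exact: measurable_funM.
pose nu : {measure set (measurableTypeR R) -> \bar R} :=
  measure_function_pushforward__canonical__measure_function_Measure leb mphi.
pose m : {measure set (measurableTypeR R) -> \bar R} := mscale (NngNum (ltW c0)) nu.
have preE (i j : bool) (a d : R) : phi @^-1` [set` Interval (BSide i a) (BSide j d)] =
    [set` Interval (BSide i (a / c)%R) (BSide j (d / c)%R)].
  apply/seteqP; split => y /=; rewrite /phi !in_itv/= ![(c * y)%R]mulrC;
    by case: i; case: j => /=; rewrite ?ler_pdivrMr ?ltr_pdivrMr ?ler_pdivlMr ?ltr_pdivlMr.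
have lebE A : measurable A -> leb A = m A.
  apply: lebesgue_measure_unique => _ [[a d] _ <-]/=.
  rewrite /m /mscale /= /nu /pushforward/= preE !lebesgue_measure_itv/= !lte_fin.
  rewrite ltr_pM2r ?invr_gt0//; case: ifP => _; last by rewrite mule0.
  by rewrite -!EFinD -EFinM -mulrBl mulrCA mulfV ?mulr1// gt_eqF.
transitivity (\int[m]_(s in `]0%R, (c * b)%R]) f s).
  by apply: eq_measure_integral => A mA _; exact: lebE.
rewrite ge0_integral_mscale//; last exact: measurable_funS mf.
congr (_ * _); rewrite ge0_integral_pushforward//; last exact: measurable_funS mf.
by rewrite preE mul0r mulrAC mulfV ?mul1r// gt_eqF.
Qed.

End lebesgue_scaling.

(** * Sigma-finiteness of the representing measure *)

Section measure_on_pos_sigma_finite.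
Context {R : realType}.
Local Open Scope ereal_scope.
Variable mu : {measure set (measurableTypeR R) -> \bar R}.
Hypothesis mu_pos : measure_on_pos mu.

(** Tonelli's theorem is applied to sigma-finite measures; for the measures at hand, finiteness on
    compact intervals is drawn from convergent integrals. *)
Lemma measure_on_pos_sigma_finite :
  (forall a b : R, (0 < a)%R -> mu `[a, b]%classic < +oo) -> sigma_finite setT mu.
Proof.
move=> mu_fin.
(* The null half-line is added to each compact interval so that the sets cover the whole line. *)
exists (fun n : nat => `]-oo, 0%R]%classic `|` `[(n.+1%:R^-1)%R, (n.+1%:R)%R]%classic).
  apply/esym; rewrite -subTset => x _ /=.
  have [x0|x0] := leP x 0%R; first by exists 0%N => //; left; rewrite /= in_itv.
  exists (Num.bound x + Num.bound (x^-1)%R)%N => //; right; rewrite /= in_itv/=.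
  apply/andP; split.
    rewrite invf_ple ?posrE// (le_trans (ltW (archi_boundP (ltW _))))//.
      by rewrite invr_gt0.
    by rewrite ler_nat leqW ?leq_addl.
  rewrite (le_trans (ltW (archi_boundP (ltW x0))))// ler_nat.
  by rewrite leqW ?leq_addr.
move=> n; split; first by apply: measurableU.
rewrite (le_lt_trans (measureU2 _ _ _))//.
rewrite [X in X + _](_ : _ = 0) ?add0e ?mu_fin//.
rewrite -mu_pos; congr (mu _); apply/seteqP; split => x /=; rewrite !in_itv/= andbT.
  by rewrite leNgt => /negP.
by rewrite leNgt => /negP.
Qed.

(** Markov's inequality: [e] times the mass of [[a, b]] is at most the integral of [k]. *)
Lemma integral_measure_on_pos_fin (k : R -> R) (D : set R) (a b : R) :
  measurable D -> measurable_fun setT k -> (forall t, 0 <= k t)%R ->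
  \int[mu]_(t in D) (k t)%:E < +oo -> `[a, b]%classic `<=` D ->
  (exists2 e : R, 0 < e & forall t, a <= t <= b -> e <= k t)%R ->
  mu `[a, b]%classic < +oo.
Proof.
move=> mD mk k0 kfin abD [e e0 ek].
have : e%:E * mu `[a, b]%classic <= \int[mu]_(t in D) (k t)%:E.
  rewrite -integral_cst//.
  apply: (@le_trans _ _ (\int[mu]_(t in `[a, b]) (k t)%:E)).
    apply: ge0_le_integral => //.
    - by move=> t _; rewrite lee_fin ltW.
    - by apply/measurable_EFinP; exact: measurable_funS mk.
  apply: ge0_subset_integral => //.
  - by apply/measurable_EFinP; exact: measurable_funS mk.
  - by move=> t _; rewrite lee_fin.
move=> /le_lt_trans/(_ kfin).
case: (mu _) => [r| |]//; first by move=> _; rewrite ltry.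
by rewrite gt0_muley// lte_fin.
Qed.

End measure_on_pos_sigma_finite.

Section cm_integral_identity.
Context {R : realType}.
Local Notation leb := (@lebesgue_measure R).
Local Open Scope ereal_scope.

(* Tonelli turns the double integral into an integral over [t] of the incomplete
   gamma integral over [s <= t], which becomes an integral over [y <= x] under
   [s = t y / x]. *)
Lemma cm_integralE (lambda x : R)
    (m : {sigma_finite_measure set (measurableTypeR R) -> \bar R}) :
  (0 < lambda)%R -> (0 < x)%R ->
  (x `^ lambda)%:E * cm_integral lambda m x =
  \int[leb]_(y in `]0%R, x]) ((y `^ (lambda - 1))%:E *
     \int[m]_(t in `]0%R, +oo[) (expR (- (y * t)))%:E).
Proof.
move=> lambda0 x0.
pose h (s : R) := (expR (- (x * s)) * s `^ (lambda - 1))%R.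
pose k (t : R) := ((t `^ lambda)^-1)%R.
have h0 s : (0 <= h s)%R by rewrite mulr_ge0 ?expR_ge0 ?powR_ge0.
have k0 t : (0 <= k t)%R by rewrite invr_ge0 powR_ge0.
have mh : measurable_fun setT h.
  by apply: measurable_funM; [exact: measurable_expRMN|exact: measurable_powR].
have mk : measurable_fun setT k.
  rewrite (_ : k = (fun t => t `^ (- lambda))%R); first exact: measurable_powR.
  by apply/funext => t; rewrite powRN.
rewrite /cm_integral -ge0_integralZl_EFin//; last 3 first.
- by move=> s _; rewrite mule_ge0 ?lee_fin ?h0// integral_ge0// => t _; rewrite lee_fin k0.
- apply: emeasurable_funM; first by apply/measurable_EFinP; exact: measurable_funS mh.
  exact: measurable_funS (measurable_integral_tail m k0 mk).
- by rewrite powR_ge0.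
transitivity (\int[leb]_(s in `]0%R, +oo[)
    ((x `^ lambda * h s)%:E * \int[m]_(t in `[s, +oo[) (k t)%:E)).
  by apply: eq_integral => s _; rewrite EFinM muleA.
rewrite (@tonelli_triangle R leb m (fun s => x `^ lambda * h s)%R k _ k0 _ mk); last 2 first.
- by move=> s; rewrite mulr_ge0 ?powR_ge0.
- exact: measurable_funM.
transitivity (\int[m]_(t in `]0%R, +oo[) \int[leb]_(y in `]0%R, x])
    (y `^ (lambda - 1) * expR (- (y * t)))%:E).
  apply: eq_integral => t; rewrite mem_setE in_itv/= andbT => t0.
  have tx0 : (0 < t / x)%R by rewrite divr_gt0.
  have tE : t = (t / x * x)%R by rewrite divfK// gt_eqF.
  rewrite {2}tE integral_scaling//; last 2 first.
  - by apply/measurable_EFinP; exact: measurable_funM.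
  - by move=> s; rewrite lee_fin mulr_ge0 ?powR_ge0.
  rewrite muleA -EFinM -ge0_integralZl_EFin//; last 3 first.
  - by move=> y _; rewrite lee_fin mulr_ge0 ?powR_ge0.
  - apply/measurable_EFinP; apply: measurable_funM => //.
    apply: (measurable_funS measurableT) => //.
    by apply: (measurableT_comp mh); exact: measurable_funM.
  - by rewrite mulr_ge0// ltW.
  apply: eq_integral => y; rewrite mem_setE in_itv/= => /andP[y0 _].
  rewrite -EFinM; congr (_%:E).
  rewrite /h /k powRM ?(ltW tx0) ?(ltW y0)//.
  have -> : (x * (t / x * y) = y * t)%R by field; rewrite gt_eqF.
  (* The Jacobian [t / x] completes the power to [(t / x) ^ lambda]; multiplied by [x ^ lambda] it
     becomes [t ^ lambda], which cancels the kernel. *)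
  have e1 : (x `^ lambda * (t / x * (t / x) `^ (lambda - 1)) = t `^ lambda)%R.
    rewrite mulr_powRB1// ?(ltW tx0)// -powRM ?(ltW x0) ?(ltW tx0)//.
    by rewrite mulrC -tE.
  transitivity ((t `^ lambda)^-1 * (x `^ lambda * (t / x * (t / x) `^ (lambda - 1))) *
     (y `^ (lambda - 1) * expR (- (y * t))))%R; first by ring.
  by rewrite e1 mulVf ?mul1r// gt_eqF// powR_gt0.
rewrite (@tonelli_rectangle R m leb
  (fun z => (z.2 `^ (lambda - 1) * expR (- (z.2 * z.1)))%:E))//; last 2 first.
- apply/measurable_EFinP; apply: measurable_funM.
    exact: (measurableT_comp (measurable_powR _)).
  apply: (measurableT_comp (f := @expR R)) => //; apply: measurableT_comp => //.
  exact: measurable_funM.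
- by move=> z; rewrite lee_fin mulr_ge0 ?powR_ge0 ?expR_ge0.
apply: eq_integral => y _; rewrite -ge0_integralZl_EFin ?powR_ge0//.
by apply/measurable_EFinP; exact: measurable_expRMN.
Qed.

End cm_integral_identity.

(** * Laplace transforms are completely monotonic *)

Section completely_monotonic_criterion.
Context {R : realType}.

Lemma near_pos (x : R) (P : R -> Prop) : 0 < x -> (forall y, 0 < y -> P y) ->
  \forall y \near x, P y.
Proof.
by move=> x0 Ppos; near=> y; apply: Ppos; near: y; exact: lt_nbhsr.
Unshelve. all: by end_near. Qed.

(** Since (0, oo) is open, agreement there passes from the functions to their derivatives. *)
Lemma completely_monotonic_of_family (u : R -> R) (d : nat -> R -> R) :
  (forall x : R, 0 < x -> u x = d 0%N x) ->
  (forall (n : nat) (x : R), 0 < x -> is_derive x 1 (d n) (d n.+1 x)) ->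
  (forall (n : nat) (x : R), 0 < x -> 0 <= (-1) ^+ n * d n x) -> completely_monotonic u.
Proof.
move=> ud dd d0.
have duE n : forall x, 0 < x -> derive1n n u x = d n x.
  elim: n => [|n ih] x x0; first exact: ud.
  rewrite derive1nS derive1E.
  have nE : \forall y \near x, derive1n n u y = d n y by exact: near_pos.
  by rewrite (near_eq_derive _ nE) (@derive_val _ _ _ _ _ _ _ (dd n x x0)).
split=> n x x0; last by rewrite duE// d0.
have nE : \forall y \near x, d n y = derive1n n u y.
  by apply: near_pos x0 _ => y y0; rewrite duE.
by apply: (near_eq_derivable nE); case: (dd n x x0).
Qed.

End completely_monotonic_criterion.

(** * Differentiation of Laplace transforms *)

Section laplace_transform.
Context {R : realType}.
Variable m : {measure set (measurableTypeR R) -> \bar R}.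
Hypothesis m_fin : forall x : R, 0 < x ->
  (\int[m]_(t in `]0%R, +oo[) (expR (- (x * t)))%:E < +oo)%E.

Let pos : set (measurableTypeR R) := `]0%R, +oo[%classic.

Let mpos : measurable pos. Proof. exact: measurable_itv. Qed.

(** Up to the sign [(-1) ^ n], the n-th derivative of the Laplace transform of [m]. *)
Definition laplace_moment (n : nat) (x : R) : R :=
  \int[m]_(t in pos) (t ^+ n * expR (- (x * t))).

Lemma exprn_le_expR (n : nat) (z : R) : 0 <= z -> z ^+ n <= n`!%:R * expR z.
Proof.
case: n => [|n] z0.
  by rewrite expr0 fact0 mul1r -[leLHS]expR0 ler_expR.
rewrite mulrC -ler_pdivrMr ?ltr0n ?fact_gt0//.
by rewrite (le_trans _ (expR_ge1Dxn n z0))// lerDr.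
Qed.

(** Half of the exponential absorbs the power, at the cost of the factor [C]; the other half is
    integrable because the transform is finite at [x / 2]. *)
Lemma integrable_laplace_moment (n : nat) (x : R) : 0 < x ->
  m.-integrable pos (fun t : measurableTypeR R => (t ^+ n * expR (- (x * t)))%:E).
Proof.
move=> x0; have x20 : 0 < x / 2 by rewrite divr_gt0.
pose C := n`!%:R * (x / 2) ^- n.
have C0 : 0 <= C by rewrite mulr_ge0 ?invr_ge0 ?exprn_ge0 ?(ltW x20).
have mf : measurable_fun pos (fun t : R => t ^+ n * expR (- (x * t))).
  by apply: measurable_funM; [exact: exprn_measurable|exact: measurable_expRMN].
apply: (@le_integrable _ (measurableTypeR R) R m pos _ _
    (fun t : measurableTypeR R => (C%:E * (expR (- (x / 2 * t)))%:E)%E)) => //. 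
- exact/measurable_EFinP.
- move=> t tpos; have t0 : 0 < t by move: tpos; rewrite /pos/= in_itv/= andbT.
  rewrite -EFinM !abse_EFin lee_fin.
  rewrite !ger0_norm ?(mulr_ge0 C0) ?mulr_ge0 ?exprn_ge0 ?expR_ge0 ?(ltW t0)//.
  have := exprn_le_expR n (mulr_ge0 (ltW x20) (ltW t0)).
  rewrite exprMn mulrC -ler_pdivlMr ?exprn_gt0// => h.
  apply: (le_trans (ler_wpM2r (expR_ge0 _) h)).
  have E : expR (x / 2 * t) * expR (- (x * t)) = expR (- (x / 2 * t)).
    by rewrite -expRD; congr expR; field.
  by rewrite -E /C mulrA [X in X * _]mulrAC.
- apply: integrableZl => //; apply/integrableP; split.
    by apply/measurable_EFinP; exact: measurable_expRMN.
  apply: le_lt_trans (m_fin x20).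
  by under eq_integral => t _ do rewrite /= ger0_norm ?expR_ge0//.
Qed.

Lemma laplace_moment_ge0 (n : nat) (x : R) : 0 <= laplace_moment n x.
Proof.
apply: Rintegral_ge0 => t; rewrite /pos/= in_itv/= andbT => t0.
by rewrite mulr_ge0 ?expR_ge0 ?exprn_ge0 ?(ltW t0).
Qed.

Lemma is_derive_laplace_moment (n : nat) (x : R) : 0 < x ->
  is_derive x 1 (laplace_moment n) (- laplace_moment n.+1 x).
Proof.
move=> x0; have x20 : 0 < x / 2 by rewrite divr_gt0.
pose f (y : R) (t : measurableTypeR R) : R := t ^+ n * expR (- (y * t)).
have df (y t : R) : is_derive y 1 (f^~ t) (- (t ^+ n.+1 * expR (- (y * t)))).
  have h := is_derive_expRM (- t) y.
  have := is_deriveZ (t ^+ n) h; rewrite /GRing.scale/=.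
  congr (is_derive _ _ _ _).
    by apply/funext => z; rewrite /f/= mulNr [z * t]mulrC.
  have -> : - t * y = - (y * t) by ring.
  by rewrite exprSr; ring.
have pE (y t : R) : partial1of2 f y t = - (t ^+ n.+1 * expR (- (y * t))).
  by rewrite partial1of2E (@derive_val _ _ _ _ _ _ _ (df y t)).
have Ix : `](x / 2), (2 * x)[%classic x by rewrite /= in_itv/=; apply/andP; split; lra.
have intf y : `](x / 2), (2 * x)[%classic y -> m.-integrable pos (EFin \o f y).
  rewrite /= in_itv/= => /andP[y0 _]; apply: integrable_laplace_moment.
  exact: lt_trans y0.
have derf (y : R) (t : measurableTypeR R) : `](x / 2), (2 * x)[%classic y -> pos t ->
    derivable (f^~ t) y 1 by move=> _ _; case: (df y t).
(* For [y > x / 2] the derivative in [y] is dominated by its absolute value at [x / 2]. *)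
pose G (t : measurableTypeR R) : R := `|t ^+ n.+1 * expR (- (x / 2 * t))|.
have intG : m.-integrable pos (EFin \o G).
  have := integrable_abse (integrable_laplace_moment n.+1 x20).
  by apply: eq_integrable => // t _.
have G_ub (y : R) (t : measurableTypeR R) : `](x / 2), (2 * x)[%classic y -> pos t ->
    `|partial1of2 f y t| <= G t.
  rewrite /pos/= !in_itv/= andbT => /andP[xy _] t0.
  rewrite pE normrN /G !normrM ler_wpM2l// !ger0_norm ?expR_ge0// ler_expR lerN2.
  by rewrite ler_wpM2r ?(ltW t0) ?(ltW xy).
have dv := derivable_under_integral mpos Ix intf derf (fun t => normr_ge0 _) intG G_ub.
have dE := differentiation_under_integral mpos Ix intf derf (fun t => normr_ge0 _) intG G_ub.
apply: DeriveDef; first exact: dv.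
rewrite -derive1E dE -[RHS]mulN1r -RintegralZl//; last exact: integrable_laplace_moment.
by apply: eq_Rintegral => t _; rewrite pE mulN1r.
Qed.

Lemma laplace_completely_monotonic (c : R) (u : R -> R) : 0 <= c ->
  (forall x : R, 0 < x -> u x = c + laplace_moment 0 x) -> completely_monotonic u.
Proof.
move=> c0 uE.
apply: (@completely_monotonic_of_family _ _ (fun n x =>
  (if n is 0 then c else 0) + (-1) ^+ n * laplace_moment n x)).
- by move=> x x0; rewrite expr0 mul1r uE.
- move=> n x x0; have := is_deriveD (is_derive_cst (if n is 0 then c else 0) x 1)
    (is_deriveZ ((-1) ^+ n) (is_derive_laplace_moment n x0)).
  congr (is_derive _ _ _ _).
  by rewrite /GRing.scale/= exprS; ring.
- move=> n x x0; rewrite mulrDr mulrA -exprMn mulrNN mulr1 expr1n mul1r.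
  rewrite addr_ge0 ?laplace_moment_ge0//.
  by case: n => [|n]; rewrite ?mulr0// expr0 mul1r.
Qed.

End laplace_transform.

(** * The representation *)

Section finiteness.
Context {R : realType}.
Local Notation leb := (@lebesgue_measure R).
Local Open Scope ereal_scope.

(** Superlevel sets within [D] are intervals. This gives measurability of tail integrals before
    sigma-finiteness is established. *)
Lemma nonincreasing_emeasurable (D : set (measurableTypeR R)) (psi : R -> \bar R) :
  measurable D -> (forall s t : R, D s -> D t -> (s <= t)%R -> psi t <= psi s) ->
  is_interval (D : set R) -> measurable_fun D psi.
Proof.
move=> mD ni iD; apply: (measurability _ (ErealGenOInfty.measurableE R)).
move=> _ [_ [r ->] <-]; apply: is_interval_measurable => s t/=.
rewrite !in_itv/= !andbT => -[Ds rs] [Dt rt] u /andP[su ut].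
have Du : D u by apply: (iD s t) => //; rewrite su.
by split => //; rewrite in_itv/= andbT (lt_le_trans rt)// ni.
Qed.

(* A non-increasing [psi] that is infinite at [s] is infinite on all of (0, s]. *)
Lemma nonincreasing_weighted_integral_fin (phi : R -> R) (psi : R -> \bar R)
    (b : itv_bound R) (s : R) :
  (forall t, 0 < t -> 0 < phi t)%R -> measurable_fun setT phi ->
  (forall t, 0 <= psi t) ->
  (forall t u : R, (0 < t)%R -> (t <= u)%R -> psi u <= psi t) ->
  \int[leb]_(t in [set` Interval (BRight 0%R) b]) ((phi t)%:E * psi t) < +oo ->
  (0 < s)%R -> (BRight s <= b)%O -> psi s < +oo.
Proof.
move=> phi0 mphi psi0 ni fin s0 sb; rewrite ltey; apply/negP => /eqP psioo.
suff : +oo < +oo :> \bar R by [].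
apply: le_lt_trans fin.
have -> : +oo = \int[leb]_(t in `]0%R, s]) ((phi t)%:E * psi t).
  transitivity (\int[leb]_(t in `]0%R, s]) (cst +oo t)).
    rewrite integral_cst//= lebesgue_measure_itv/= lte_fin s0 oppr0 adde0.
    by rewrite gt0_mulye// lte_fin.
  apply: eq_integral => t; rewrite mem_setE in_itv/= => /andP[t0 ts].
  have -> : psi t = +oo by apply/eqP; rewrite eq_le leey/= -psioo ni.
  by rewrite gt0_muley// lte_fin phi0.
apply: ge0_subset_integral => //.
- apply: emeasurable_funM; first by apply/measurable_EFinP; exact: measurable_funS mphi.
  apply: nonincreasing_emeasurable => //.
  + move=> t u; rewrite /= !itv_boundlr/= => /andP[t0 _] _; apply: ni.
    by move: t0; rewrite bnd_simp.
  + exact: interval_is_interval.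
- move=> t; rewrite /= !itv_boundlr/= bnd_simp => /andP[t0 _].
  by rewrite mule_ge0// lee_fin ltW// phi0.
- by apply: subset_itvl.
Qed.

End finiteness.

(** * The fundamental theorem of calculus up to the endpoint 0 *)

Section improper_ftc.
Context {R : realType}.
Local Notation leb := (@lebesgue_measure R).

(** The integrand may blow up at 0, so the theorem is applied on [[e i, x]], and monotone
    convergence handles the limit as [e i] tends to 0. *)
Lemma ge0_FTC2_at0 (h k : R -> R) (beta : R) :
  (forall x : R, 0 < x -> is_derive x 1 h (k x)) ->
  (forall x : R, 0 < x -> {for x, continuous k}) ->
  (forall x : R, 0 < x -> 0 <= k x) ->
  h y @[y --> 0^'+] --> beta ->
  forall x, 0 < x -> (\int[leb]_(y in `]0%R, x]) (k y)%:E = (h x - beta)%:E)%E.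
Proof.
move=> hk ck k0 hbeta x x0.
(* Dividing by [i.+2] keeps [e i < x] already at [i = 0]. *)
pose e (i : nat) : R := x / i.+2%:R.
have e0 i : 0 < e i by rewrite divr_gt0.
have ex i : e i < x by rewrite ltr_pdivrMr// ltr_pMr// ltr1n.
pose F (i : nat) : set (measurableTypeR R) := `[e i, x]%classic.
have ecvg : e i @[i --> \oo] --> 0.
  have hs : [sequence (@harmonic R) n.+1]_n @ \oo --> (0 : R).
    by rewrite cvg_shiftS; exact: cvg_harmonic.
  by rewrite -(mulr0 x); apply: cvgM hs; exact: cvg_cst.
have UF : \bigcup_i F i = (`]0, x]%classic : set (measurableTypeR R)).
  apply/seteqP; split => y /=.
    by move=> [i _]; rewrite /F/= !in_itv/= => /andP[ey ->]; rewrite (lt_le_trans (e0 i) ey).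
  rewrite in_itv/= => /andP[y0 yx].
  have [N _ /(_ N (leqnn N))] : \forall i \near \oo, e i <= y.
    move/cvgrPdist_le : ecvg => /(_ _ y0); apply: filterS => i.
    by rewrite sub0r normrN ger0_norm ?(ltW (e0 i)).
  by move=> eN; exists N => //; rewrite /F/= in_itv/= eN.
have kpos : measurable_fun (`]0, +oo[%classic : set R) k.
  apply: open_continuous_measurable_fun; first exact: interval_open.
  by move=> y; rewrite inE/= in_itv/= andbT => /ck.
have lim1 : (\int[leb]_(y in F i) (k y)%:E)%E @[i --> \oo] -->
    (\int[leb]_(y in `]0%R, x]) (k y)%:E)%E.
  rewrite -UF; apply: ge0_nondecreasing_set_cvg_integral.
  - apply/nondecreasing_seqP => i; rewrite subsetEset; apply: subset_itvr.
    by rewrite bnd_simp ler_pM2l// lef_pV2 ?posrE// ler_nat.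
  - by move=> i; exact: measurable_itv.
  - move=> i; apply/measurable_EFinP; apply: measurable_funS kpos => // y.
    by rewrite /F/= !in_itv/= andbT => /andP[ey _]; exact: lt_le_trans ey.
  - move=> i y; rewrite /F/= in_itv/= lee_fin => /andP[ey _].
    by rewrite k0// (lt_le_trans _ ey).
apply: (cvg_unique _ lim1) => //.
have FE i : (\int[leb]_(y in F i) (k y)%:E = (h x - h (e i))%:E)%E.
  have hc (y : R) : 0 < y -> h z @[z --> y] --> h y.
    move=> y0; have : {for y, continuous h}.
      apply: differentiable_continuous; apply/derivable1_diffP.
      by case: (hk y y0).
    exact.
  rewrite EFinB /F; apply: continuous_FTC2 => //.
  - apply: continuous_in_subspaceT => y /set_mem /=; rewrite in_itv/= => /andP[ey _].
    exact/ck/(lt_le_trans (e0 i)).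
  - split.
    + move=> y; rewrite in_itv/= => /andP[ey _].
      by case: (hk y (lt_trans (e0 i) ey)).
    + exact/cvg_at_right_filter/hc.
    + exact/cvg_at_left_filter/hc.
  - move=> y; rewrite in_itv/= => /andP[ey _].
    by rewrite derive1E (@derive_val _ _ _ _ _ _ _ (hk y (lt_trans (e0 i) ey))).
rewrite (eq_fun FE); apply: cvg_EFin; first exact: nearW.
apply: cvgB; first exact: cvg_cst.
have /cvg_at_rightP := hbeta; apply; split => //.
Qed.

End improper_ftc.

(** Only the structure is enriched: the underlying measure stays [mu], so integrals against either
    are convertible. *)
Definition sigma_finite_pack (R : realType)
    (mu : {measure set (measurableTypeR R) -> \bar R}) (sf : sigma_finite setT mu) :
    {sigma_finite_measure set (measurableTypeR R) -> \bar R} :=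
  HB.pack_for (SigmaFiniteMeasure.type (measurableTypeR R) R) (Measure.sort mu)
    (Measure.class mu) (isSFinite.Build _ _ _ mu (sfinite_measure_sigma_finite sf))
    (isSigmaFinite.Build _ _ _ mu sf).

(** * The two implications of the representation theorem *)

Section euler_operator.
Context {R : realType}.
Local Notation leb := (@lebesgue_measure R).
Variables (lambda : R) (f : R -> R).
Hypothesis lambda_gt0 : 0 < lambda.

Let h (y : R) : R := y `^ lambda * f y.
Let l (x : R) : R := x `^ (1 - lambda) * derive1 h x.

Lemma powR_mul_compl (x : R) : 0 < x -> x `^ (1 - lambda) * x `^ (lambda - 1) = 1.
Proof.
move=> x0; rewrite -powRD; last by rewrite (gt_eqF x0) implybT.
by rewrite addrA subrK subrr powRr0.
Qed.

Lemma is_derive_powR_mul (x : R) : 0 < x -> derivable f x 1 ->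
  is_derive x 1 (fun y : R => y `^ lambda * f y)
    (x `^ (lambda - 1) * (lambda * f x + x * derive1 f x)).
Proof.
move=> x0 df; have hf : is_derive x 1 f (derive1 f x).
  by rewrite derive1E; exact: derivableP.
have := is_deriveM (is_derive1_powR lambda x0) hf.
congr (is_derive _ _ _ _).
rewrite /GRing.scale/= -(mulr_powRB1 (ltW x0) lambda_gt0); ring.
Qed.

Lemma euler_operatorE (x : R) : 0 < x -> derivable f x 1 ->
  l x = lambda * f x + x * derive1 f x.
Proof.
move=> x0 df; rewrite /l derive1E (@derive_val _ _ _ _ _ _ _ (is_derive_powR_mul x0 df)).
by rewrite mulrA powR_mul_compl// mul1r.
Qed.

Hypothesis f_ge0 : forall x : R, 0 < x -> 0 <= f x.
Hypothesis f_smooth : smooth_pos f.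

Lemma is_derive_h (x : R) : 0 < x -> is_derive x 1 h (x `^ (lambda - 1) * l x).
Proof.
move=> x0; have df : derivable f x 1 by exact: (@f_smooth 0%N x x0).
by rewrite euler_operatorE//; exact: is_derive_powR_mul.
Qed.

Lemma euler_cm_representation : completely_monotonic l ->
  exists (alpha beta : R) (mu : {measure set (measurableTypeR R) -> \bar R}),
     [/\ 0 <= alpha, 0 <= beta, measure_on_pos mu,
         forall x : R, 0 < x -> (cm_integral lambda mu x < +oo)%E &
         forall x : R, 0 < x ->
           f x = alpha + beta / x `^ lambda + fine (cm_integral lambda mu x)].
Proof.
move=> cml; have [c [mu [c0 mu_pos lE]]] := bernstein cml.
have GE (x : R) : 0 < x ->
    (\int[mu]_(s in `]0%R, +oo[) (expR (- (x * s)))%:E = (l x - c)%:E)%E.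
  by move=> x0; rewrite EFinB lE// addeAC subee// add0e.
(* On [[a, b]] the integrand of the transform at 1 is at least [expR (- b)], and that transform is
   finite. *)
have sf : sigma_finite setT mu.
  apply: measure_on_pos_sigma_finite => // a b a0.
  apply: (@integral_measure_on_pos_fin R mu
    (fun s => expR (- (1 * s))) `]0, +oo[%classic) => //.
  - exact: measurable_expRMN.
  - by rewrite GE// ltry.
  - by move=> t /=; rewrite !in_itv/= andbT => /andP[at_ _]; exact: lt_le_trans at_.
  - exists (expR (- b)); first exact: expR_gt0.
    by move=> t /andP[_ tb]; rewrite mul1r ler_expR lerN2.
pose m := sigma_finite_pack sf.
pose k (y : R) := y `^ (lambda - 1) * (l y - c).
have lc (x : R) : 0 < x -> 0 <= l x - c.
  move=> x0; rewrite -lee_fin -GE//; apply: integral_ge0 => t _.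
  exact: expR_ge0.
(* [h] is non-negative because [f] is, and nondecreasing because its derivative
   [x ^ (lambda - 1) * l x] is non-negative, so it has a finite limit at 0. *)
have [beta [beta0 hbeta]] : exists beta : R, 0 <= beta /\ h y @[y --> 0^'+] --> beta.
  have hnd (x y : R) : 0 < x -> x <= y -> h x <= h y.
    move=> x0 xy; apply: (@ge0_is_derive_le R h
      (fun x => x `^ (lambda - 1) * l x) x (y + 1)) => //.
    - move=> z /andP[xz _]; apply: is_derive_h; exact: lt_le_trans xz.
    - move=> z /andP[xz _]; rewrite mulr_ge0 ?powR_ge0//.
      by apply: completely_monotonic_ge0 => //; exact: lt_le_trans xz.
    - by rewrite ltrDl.
  have h0 (y : R) : 0 < y -> 0 <= h y by move=> y0; rewrite mulr_ge0 ?powR_ge0 ?f_ge0.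
  have hc : cvg (h y @[y --> 0^'+]).
    apply: nondecreasing_at_right_is_cvgr; apply: nearW => z.
      move=> x y; rewrite !in_itv/= => /andP[x0 _] _; exact: hnd.
    by exists 0 => _ [y /= + <-]; rewrite in_itv/= => /andP[y0 _]; exact: h0.
  exists (lim (h y @[y --> 0^'+])); split => //.
  by apply: limr_ge => //; near=> y; exact: h0.
(* Subtracting [c / lambda * y ^ lambda] from [h] removes the constant [c] of Bernstein's formula
   from the derivative, and does not change the limit at 0. *)
have FTC (x : R) : 0 < x ->
    (\int[leb]_(y in `]0%R, x]) (k y)%:E = (h x - c / lambda * x `^ lambda - beta)%:E)%E.
  move: x; apply: (@ge0_FTC2_at0 R (fun y => h y - c / lambda * y `^ lambda) k beta).
  - move=> x x0; have := is_deriveB (is_derive_h x0)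
      (is_deriveZ (c / lambda) (is_derive1_powR lambda x0)).
    congr (is_derive _ _ _ _).
    by rewrite /GRing.scale/= /k; field; rewrite gt_eqF.
  - move=> x x0; apply: cvgM.
      have : {for x, continuous (fun y : R => y `^ (lambda - 1))}.
        apply: differentiable_continuous; apply/derivable1_diffP.
        by case: (is_derive1_powR (lambda - 1) x0).
      exact.
    apply: cvgB; last exact: cvg_cst.
    have /derivable1_diffP/differentiable_continuous := cml.1 0%N x x0.
    exact.
  - by move=> x x0; rewrite mulr_ge0 ?powR_ge0 ?lc.
  - rewrite -[beta in X in _ --> X]subr0; apply: cvgB => //.
    rewrite -[X in _ --> X](mulr0 (c / lambda)); apply: cvgM; first exact: cvg_cst.
    exact: powR_cvg0.
have cmE (x : R) : 0 < x ->
    cm_integral lambda mu x = (f x - c / lambda - beta / x `^ lambda)%:E.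
  move=> x0; have xl0 : 0 < x `^ lambda by rewrite powR_gt0.
  have := cm_integralE m lambda_gt0 x0.
  have -> : (\int[leb]_(y in `]0%R, x]) ((y `^ (lambda - 1))%:E *
      \int[m]_(t in `]0%R, +oo[) (expR (- (y * t)))%:E) =
      \int[leb]_(y in `]0%R, x]) (k y)%:E)%E.
    apply: eq_integral => y; rewrite mem_setE in_itv/= => /andP[y0 _].
    by rewrite (GE y y0) -EFinM.
  rewrite FTC// => E.
  rewrite -[LHS]mul1e -(mulVf (lt0r_neq0 xl0)) EFinM -muleA E -EFinM /h.
  by congr (_%:E); field; rewrite !gt_eqF.
exists (c / lambda), beta, mu; split => //.
- by rewrite divr_ge0// ltW.
- by move=> x x0; rewrite cmE// ltry.
- by move=> x x0; rewrite cmE//=; ring.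
Unshelve. all: by end_near. Qed.

Lemma representation_euler_cm (alpha beta : R)
    (mu : {measure set (measurableTypeR R) -> \bar R}) :
  0 <= alpha -> 0 <= beta -> measure_on_pos mu ->
  (forall x : R, 0 < x -> (cm_integral lambda mu x < +oo)%E) ->
  (forall x : R, 0 < x ->
     f x = alpha + beta / x `^ lambda + fine (cm_integral lambda mu x)) ->
  completely_monotonic l.
Proof.
move=> alpha0 beta0 mu_pos cm_fin fE.
have kl0 (t : R) : 0 <= (t `^ lambda)^-1 by rewrite invr_ge0 powR_ge0.
have mkl : measurable_fun setT (fun t : R => (t `^ lambda)^-1).
  rewrite (_ : (fun _ => _) = (fun t => t `^ (- lambda))); first exact: measurable_powR.
  by apply/funext => t; rewrite powRN.
(* The tail is nonincreasing in [s], and its weighted integral is the double integral at [x = 1]. *)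
have tail_fin (s : R) : 0 < s -> (\int[mu]_(t in `[s, +oo[) ((t `^ lambda)^-1)%:E < +oo)%E.
  move=> s0.
  apply: (@nonincreasing_weighted_integral_fin R
    (fun t => expR (- (1 * t)) * t `^ (lambda - 1))
    (fun s => \int[mu]_(t in `[s, +oo[) ((t `^ lambda)^-1)%:E)%E +oo%O s) => //.
  - by move=> t t0; rewrite mulr_gt0 ?expR_gt0 ?powR_gt0.
  - by apply: measurable_funM; [exact: measurable_expRMN|exact: measurable_powR].
  - by move=> t; rewrite integral_ge0// => u _; rewrite lee_fin.
  - move=> t u t0 tu; apply: ge0_subset_integral => //.
    + by apply/measurable_EFinP; exact: measurable_funS mkl.
    + by move=> v _; rewrite lee_fin.
    + exact: subset_itvr.
  - exact: (cm_fin 1).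
have sf : sigma_finite setT mu.
  apply: measure_on_pos_sigma_finite => // a b a0.
  apply: (@integral_measure_on_pos_fin R mu
    (fun t => (t `^ lambda)^-1) `[a, +oo[%classic) => //.
  - exact: tail_fin.
  - exact: subset_itvl.
  (* [b] is arbitrary and may lie below [a]; the maximum keeps the lower bound on the kernel
     positive. *)
  - have M0 : 0 < Num.max a b by rewrite lt_max a0.
    exists ((Num.max a b) `^ lambda)^-1; first by rewrite invr_gt0 powR_gt0.
    move=> t /andP[at_ tb]; have t0 := lt_le_trans a0 at_.
    rewrite lef_pV2 ?posrE ?powR_gt0//.
    rewrite ge0_ler_powR ?nnegrE ?(ltW t0) ?(ltW M0) ?(ltW lambda_gt0)//.
    by rewrite le_max tb orbT.
pose m := sigma_finite_pack sf.
pose G (y : R) : \bar R := (\int[m]_(t in `]0%R, +oo[) (expR (- (y * t)))%:E)%E.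
have G0 y : (0 <= G y)%E by rewrite integral_ge0// => t _; rewrite lee_fin expR_ge0.
have cmE (x : R) : 0 < x -> ((x `^ lambda * fine (cm_integral lambda mu x))%:E =
    \int[leb]_(y in `]0%R, x]) ((y `^ (lambda - 1))%:E * G y))%E.
  move=> x0; rewrite EFinM fineK; first exact: cm_integralE m lambda_gt0 x0.
  rewrite ge0_fin_numE ?cm_fin// /cm_integral integral_ge0// => s _.
  rewrite mule_ge0 ?lee_fin ?mulr_ge0 ?expR_ge0 ?powR_ge0// integral_ge0// => t _.
  by rewrite lee_fin.
(* [G] is nonincreasing, and its weighted integral over []0, y]] is finite by the identity for the
   double integral. *)
have G_fin (y : R) : 0 < y -> (G y < +oo)%E.
  move=> y0.
  apply: (@nonincreasing_weighted_integral_fin R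
    (fun y => y `^ (lambda - 1)) G (BRight y) y) => //.
  - by move=> t t0; rewrite powR_gt0.
  - move=> t u t0 tu; apply: ge0_le_integral => //.
    + by apply/measurable_EFinP; exact: measurable_expRMN.
    + by apply/measurable_EFinP; exact: measurable_expRMN.
    + move=> v; rewrite /= in_itv/= andbT => v0.
      by rewrite lee_fin ler_expR lerN2 ler_wpM2r// ltW.
  - by rewrite -cmE// ltry.
pose L := laplace_moment m 0.
have GL (y : R) : 0 < y -> G y = (L y)%:E.
  move=> y0; have -> : L y = fine (G y).
    by congr fine; apply: eq_integral => t _; rewrite expr0 mul1r.
  by rewrite fineK// ge0_fin_numE// G_fin.
have dL (y : R) : 0 < y -> {for y, continuous L}.
  move=> y0; apply: differentiable_continuous; apply/derivable1_diffP.
  by case: (is_derive_laplace_moment G_fin 0 y0).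
pose k (y : R) := y `^ (lambda - 1) * L y.
have L0 y : 0 <= L y by exact: laplace_moment_ge0.
have k0 y : 0 <= k y by rewrite mulr_ge0 ?powR_ge0.
have mk : measurable_fun (`]0, +oo[%classic : set R) k.
  apply: measurable_funM.
    by apply: (measurable_funS measurableT) => //; exact: measurable_powR.
  apply: open_continuous_measurable_fun; first exact: interval_open.
  by move=> y; rewrite inE/= in_itv/= andbT => /dL.
have kE (x : R) : 0 < x -> (\int[leb]_(y in `]0%R, x]) (k y)%:E =
    (x `^ lambda * fine (cm_integral lambda mu x))%:E)%E.
  move=> x0; rewrite cmE//; apply: eq_integral => y.
  by rewrite mem_setE in_itv/= => /andP[y0 _]; rewrite GL.
have intk (x : R) : 0 < x -> leb.-integrable (`]0, x]%classic : set (measurableTypeR R))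
    (EFin \o k).
  move=> x0; apply/integrableP; split.
    by apply/measurable_EFinP; apply: measurable_funS mk => //; exact: subset_itvl.
  apply: (@le_lt_trans _ _ (\int[leb]_(y in `]0%R, x]) (k y)%:E)%E); last by rewrite kE// ltry.
  by under eq_integral => y _ do rewrite /= ger0_norm//.
(* Near [x], [h] is [alpha * y ^ lambda + beta] plus a primitive of [k]. Differentiating removes
   [beta], and the factor [x ^ (1 - lambda)] leaves [alpha * lambda + L x]. *)
have lE (x : R) : 0 < x -> l x = alpha * lambda + L x.
  move=> x0.
  pose F (y : R) : R := \int[leb]_(t in `]0%R, y]) k t.
  have hE : \forall y \near x, alpha * y `^ lambda + beta + F y = h y.
    apply: near_pos x0 _ => y y0; rewrite /h fE// /F /Rintegral kE//=.
    by field; rewrite gt_eqF// powR_gt0.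
  have ck : {for x, continuous k}.
    apply: continuousM; last exact: dL.
    apply: differentiable_continuous; apply/derivable1_diffP.
    by case: (is_derive1_powR (lambda - 1) x0).
  have x1 : x < x + 1 by rewrite ltrDl.
  have bx : (BRight (0 : R) < BRight x)%O by rewrite bnd_simp.
  have [dF FE] := @continuous_FTC1 R k (BRight 0) x (x + 1) x1
    (intk _ (lt_trans x0 x1)) bx ck.
  have hF : is_derive x 1 F (k x).
    by rewrite -FE derive1E; exact: derivableP.
  have := is_deriveD (is_deriveD (is_deriveZ alpha (is_derive1_powR lambda x0))
    (is_derive_cst beta x 1)) hF.
  move=> hD; rewrite /l derive1E -(near_eq_derive _ hE) (@derive_val _ _ _ _ _ _ _ hD).
  rewrite /GRing.scale/= addr0 /k mulrDr [X in _ + X = _]mulrA powR_mul_compl// mul1r.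
  congr (_ + _).
  transitivity (alpha * lambda * (x `^ (1 - lambda) * x `^ (lambda - 1))).
    by ring.
  by rewrite powR_mul_compl// mulr1.
apply: (@laplace_completely_monotonic R m G_fin (alpha * lambda) l) => //.
by rewrite mulr_ge0// ltW.
Qed.

End euler_operator.

Unset Implicit Arguments.
Set Strict Implicit.
Set Printing Implicit Defensive.

Theorem corollary1p7 (R : realType) (lambda : R) (f : R -> R)
    (lambda_gt0 : 0 < lambda)
    (f_ge0 : forall x : R, 0 < x -> 0 <= f x)
    (f_smooth : smooth_pos f) :
  (forall x : R, 0 < x ->
     x `^ (1 - lambda) * derive1 (fun y : R => y `^ lambda * f y) x =
     lambda * f x + x * derive1 f x) /\
  (completely_monotonic
     (fun x : R =>
        x `^ (1 - lambda) * derive1 (fun y : R => y `^ lambda * f y) x) <->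
   exists (alpha beta : R)
          (mu : {measure set (measurableTypeR R) -> \bar R}),
     [/\ 0 <= alpha, 0 <= beta, measure_on_pos mu,
         forall x : R, 0 < x -> (cm_integral lambda mu x < +oo)%E &
         forall x : R, 0 < x ->
           f x = alpha + beta / x `^ lambda + fine (cm_integral lambda mu x)]).
Proof.
split=> [x x0|]; first exact: euler_operatorE (f_smooth 0%N x x0).
split; first exact: euler_cm_representation.
move=> [alpha [beta [mu [alpha0 beta0 mu_pos cm_fin fE]]]].
exact: representation_euler_cm alpha0 beta0 mu_pos cm_fin fE.
Qed.
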